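(* Let $(\mathcal A,p_n)_{n\in\mathbb N}$ be a Fréchet algebra and $I$ a closed ideal of $\mathcal A$. Then the following are equivalent: (i) $\mathcal A$ is amenable modulo $I$; (ii) for each Arens–Michael decomposition $\mathcal A=\varprojlim \mathcal A_n$ of $\mathcal A$, every Banach algebra $\mathcal A_n$ is amenable modulo $\overline{I_n}$, where $I_n=\varphi_n(I)$ and $I=\varprojlim\overline{I_n}$ is the corresponding Arens–Michael decomposition of $I$.
   Context: A Fréchet algebra $(\mathcal A,p_n)$ is a complete topological algebra whose topology is given by a countable increasing family of submultiplicative seminorms. Arens–Michael decomposition: for each $n$, $\mathcal A/\ker p_n$ is a normed algebra with $\|a+\ker p_n\|_n=p_n(a)$; $\mathcal A_n$ is its completion (a Banach algebra), $\varphi_n:\mathcal A\to\mathcal A_n$, $a\mapsto a+\ker p_n$, is the canonical map, the linking maps $\mathcal A_m\to\mathcal A_n$ ($n\le m$) extend $a+\ker p_m\mapsto a+\ker p_n$, and $\mathcal A$ is identified with the inverse limit $\varprojlim\mathcal A_n$; similarly $I$ is identified with $\varprojlim \overline{I_n}$, $\overline{I_n}$ the closure of $\varphi_n(I)$ in $\mathcal A_n$. For a Fréchet (in particular Banach) algebra $\mathcal A$ and closed ideal $I$, $\mathcal A$ is amenable modulo $I$ if for every Banach $\mathcal A$-bimodule $E$ (Banach space with separately continuous bimodule actions) with $E.I=I.E=0$ and every continuous derivation $D:\mathcal A\to E^*$ there exists $\eta\in E^*$ with $D(a)=a.\eta-\eta.a$ for all $a\in\mathcal A\setminus I$. *)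

(* Defs.v *)
From HB Require Import structures.
From mathcomp Require Import all_boot all_order all_algebra.
From mathcomp Require Import all_classical all_reals all_analysis.
From mathcomp Require Import complex.
Set Implicit Arguments. Unset Strict Implicit. Unset Printing Implicit Defensive.
Import Order.TTheory GRing.Theory Num.Theory.
Import numFieldNormedType.Exports.
Local Open Scope ring_scope.
Local Open Scope classical_set_scope.

Section Defs.
Variable K : numFieldType.

Definition is_algebra_mul (A : lmodType K) (mul : A -> A -> A) : Prop :=
  [/\ forall a b c, mul a (mul b c) = mul (mul a b) c,
      forall (k : K) a b c, mul (k *: a + b) c = k *: mul a c + mul b c &
      forall (k : K) a b c, mul a (k *: b + c) = k *: mul a b + mul a c].

Definition is_seminorm (A : lmodType K) (q : A -> K) : Prop :=
  [/\ forall x, 0 <= q x,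
      forall x y, q (x + y) <= q x + q y &
      forall (k : K) x, q (k *: x) = `|k| * q x].

(* The topology on A is the one generated by the increasing family (q n)_n;
   since the family is increasing, the sets {b | q n (b - a) < d} form a
   neighbourhood base at a. *)

Definition sn_continuous (A : lmodType K) (q : nat -> A -> K)
  (X : normedModType K) (f : A -> X) : Prop :=
  forall a (e : K), 0 < e -> exists n, exists2 d : K, 0 < d &
    forall b, q n (b - a) < d -> `|f b - f a| < e.

Definition sn_closed (A : lmodType K) (q : nat -> A -> K) (S : set A) : Prop :=
  forall x, (forall n (e : K), 0 < e -> exists2 y, S y & q n (x - y) < e) -> S x.

(* completeness (the topology is metrizable, so sequential completeness) *)
Definition sn_complete (A : lmodType K) (q : nat -> A -> K) : Prop :=
  forall u : nat -> A,
    (forall n (e : K), 0 < e -> exists N, forall i j, (N <= i)%N -> (N <= j)%N ->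
        q n (u i - u j) < e) ->
    exists l, forall n (e : K), 0 < e -> exists N, forall i, (N <= i)%N ->
        q n (u i - l) < e.

Definition frechet_algebra (A : lmodType K) (mul : A -> A -> A)
  (p : nat -> A -> K) : Prop :=
  [/\ is_algebra_mul mul /\ (forall n, is_seminorm (p n)),
      forall n a b, p n (mul a b) <= p n a * p n b,
      forall n a, p n a <= p n.+1 a,
      forall a, (forall n, p n a = 0) -> a = 0 &
      sn_complete p].

Definition banach_algebra (B : completeNormedModType K) (mul : B -> B -> B) : Prop :=
  is_algebra_mul mul /\ forall a b : B, `|mul a b| <= `|a| * `|b|.

Definition is_ideal (A : lmodType K) (mul : A -> A -> A) (I : set A) : Prop :=
  [/\ I 0,
      forall (k : K) x y, I x -> I y -> I (k *: x + y) &
      forall a x, I x -> I (mul a x) /\ I (mul x a)].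

Definition closed_ideal (A : lmodType K) (mul : A -> A -> A) (q : nat -> A -> K)
  (I : set A) : Prop := is_ideal mul I /\ sn_closed q I.

Definition banach_bimodule (A : lmodType K) (mul : A -> A -> A) (q : nat -> A -> K)
  (E : completeNormedModType K) (l : A -> E -> E) (r : E -> A -> E) : Prop :=
  [/\ (forall (k : K) a b x, l (k *: a + b) x = k *: l a x + l b x)
      /\ (forall (k : K) a x y, l a (k *: x + y) = k *: l a x + l a y),
      (forall (k : K) a b x, r x (k *: a + b) = k *: r x a + r x b)
      /\ (forall (k : K) a x y, r (k *: x + y) a = k *: r x a + r y a),
      [/\ forall a b x, l (mul a b) x = l a (l b x),
           forall a b x, r x (mul a b) = r (r x a) b &
           forall a b x, l a (r x b) = r (l a x) b],
      (forall a, continuous (l a)) /\ (forall a, continuous (fun x => r x a)) &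
      (forall x, sn_continuous q (fun a => l a x))
      /\ (forall x, sn_continuous q (fun a => r x a))].

Definition dual_elt (E : normedModType K) (f : E -> K) : Prop :=
  (forall (k : K) x y, f (k *: x + y) = k * f x + f y) /\ continuous f.

(* Continuous derivation D : A -> E^*, where E^* carries the dual module
   actions (a.f)(x) = f(x.a), (f.a)(x) = f(a.x) and the dual (operator) norm
   ||f|| = sup_{||x|| <= 1} |f x|.  D a is represented as a function E -> K. *)
Definition cont_derivation (A : lmodType K) (mul : A -> A -> A) (q : nat -> A -> K)
  (E : normedModType K) (l : A -> E -> E) (r : E -> A -> E) (D : A -> E -> K) : Prop :=
  [/\ forall a, dual_elt (D a),
      forall (k : K) a b x, D (k *: a + b) x = k * D a x + D b x,
      (* D(ab) = a.D(b) + D(a).b *)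
      forall a b x, D (mul a b) x = D b (r x a) + D a (l b x) &
      forall a (e : K), 0 < e -> exists n, exists2 d : K, 0 < d &
        forall b, q n (b - a) < d ->
          forall x : E, `|x| <= 1 -> `|D b x - D a x| <= e].

Definition amenable_modulo (A : lmodType K) (mul : A -> A -> A) (q : nat -> A -> K)
  (I : set A) : Prop :=
  forall (E : completeNormedModType K) (l : A -> E -> E) (r : E -> A -> E),
    banach_bimodule mul q l r ->
    (forall a x, I a -> l a x = 0 /\ r x a = 0) ->
    forall D : A -> E -> K, cont_derivation mul q l r D ->
    exists eta : E -> K, dual_elt eta /\
      forall a, ~ I a -> forall x, D a x = eta (r x a) - eta (l a x).

(* (B, mulB, phi) realises the n-th Arens–Michael factor A_n of (A, p):
   B is a Banach algebra and phi : A -> B an algebra homomorphism with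
   ||phi a|| = p n a (so phi induces an isometry A/ker p_n -> B) and dense
   range, i.e. B is a completion of (A/ker p_n, ||.||_n) and phi = phi_n. *)
Definition arens_michael_factor (A : lmodType K) (mul : A -> A -> A)
  (p : nat -> A -> K) (n : nat)
  (B : completeNormedModType K) (mulB : B -> B -> B) (phi : A -> B) : Prop :=
  [/\ banach_algebra mulB,
      forall (k : K) a b, phi (k *: a + b) = k *: phi a + phi b,
      forall a b, phi (mul a b) = mulB (phi a) (phi b),
      forall a, `|phi a| = p n a &
      forall (y : B) (e : K), 0 < e -> exists a, `|y - phi a| < e].

Definition closure_image (A : lmodType K) (B : normedModType K) (phi : A -> B)
  (I : set A) : set B :=
  [set y | forall e : K, 0 < e -> exists2 a, I a & `|y - phi a| < e].

Definition norm_family (B : normedModType K) : nat -> B -> K := fun _ x => `|x|.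

End Defs.

(* Main.v *)
(* (i) => (ii): a derivation of a factor pulls back along phi_n; the functional
   implementing the pull-back outside I implements the original one outside the
   closure of phi_n(I), by density of the range of phi_n.

   (ii) => (i): by uniform boundedness the module actions and the derivation D
   are controlled by a single p_n, so they extend to A_n, realised as the
   completion of (A, p_n). If I = A there is nothing to prove; otherwise some
   a0 lies outside I, and n can be taken large enough for phi_n(a0) to lie
   outside the closure J of phi_n(I). Let eta implement the extension of D
   outside J. It remains to treat the a outside I with phi_n(a) in J: there
   both actions vanish, and so does D, because phi_n(a0) and phi_n(a0 + a) are
   outside J and have the same commutator with eta. *)
Require Import Defs.
From HB Require Import structures.
From mathcomp Require Import all_boot all_order all_algebra.
From mathcomp Require Import all_classical all_reals all_analysis.
From mathcomp Require Import complex.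
Set Implicit Arguments.
Unset Strict Implicit.
Unset Printing Implicit Defensive.
Import Order.TTheory GRing.Theory Num.Theory.
Import numFieldNormedType.Exports.
Local Open Scope ring_scope.
Local Open Scope complex_scope.

(** * Estimates over a numeric field, seminorms, Cauchy sequences and Baire's theorem *)

Section Scalars.
Variable K : numFieldType.

(** Limit argument for $d\to 0$: the choice $d=e/(M+1)$ makes the error at most $e$, and the $+1$
    covers $M=0$. *)
Lemma small_le (x c M : K) : 0 <= M ->
  (forall d, 0 < d -> x <= c + M * d) -> x <= c.
Proof.
move=> M0 h; apply/ler_addgt0Pr => e e0.
have M1 : 0 < M + 1 by rewrite ltr_wpDl.
apply: le_trans (h (e / (M + 1)) _) _; first by rewrite divr_gt0.
rewrite lerD2l mulrCA ger_pMr// ler_pdivrMr// mul1r.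
by rewrite lerDl.
Qed.

Lemma small_norm (V : normedModType K) (v : V) (M : K) : 0 <= M ->
  (forall d, 0 < d -> `|v| <= M * d) -> v = 0.
Proof.
move=> M0 h; apply/eqP; rewrite -normr_le0; apply: (small_le M0) => d d0.
by rewrite add0r h.
Qed.

(** The order of [K] is only partial, so half the harmonic mean replaces the minimum. *)
Lemma pos_lower_bound (a b : K) : 0 < a -> 0 < b ->
  exists c, [/\ 0 < c, c <= a & c <= b].
Proof.
move=> a0 b0; exists (a^-1 + b^-1)^-1.
have ab : 0 < a^-1 + b^-1 by rewrite addr_gt0 ?invr_gt0.
split; first by rewrite invr_gt0.
  by rewrite -[leRHS]invrK lef_pV2 ?posrE ?invr_gt0// lerDl ltW// invr_gt0.
by rewrite -[leRHS]invrK lef_pV2 ?posrE ?invr_gt0// lerDr ltW// invr_gt0.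
Qed.

Lemma seminorm_ge0 (V : lmodType K) (q : V -> K) v : is_seminorm q -> 0 <= q v.
Proof. by case. Qed.

Lemma seminormN (V : lmodType K) (q : V -> K) v :
  is_seminorm q -> q (- v) = q v.
Proof. by case=> _ _ qZ; rewrite -scaleN1r qZ normrN normr1 mul1r. Qed.

Lemma seminorm0 (V : lmodType K) (q : V -> K) : is_seminorm q -> q 0 = 0.
Proof. by case=> _ _ qZ; rewrite -(scale0r 0) qZ normr0 mul0r. Qed.

Lemma seminorm_distC (V : lmodType K) (q : V -> K) v w :
  is_seminorm q -> q (v - w) = q (w - v).
Proof. by move=> hq; rewrite -opprB seminormN. Qed.

Lemma seminorm_distD (V : lmodType K) (q : V -> K) z v w :
  is_seminorm q -> q (v - w) <= q (v - z) + q (z - w).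
Proof. by case=> _ qD _; rewrite -(subrKA z v) qD. Qed.

Lemma norm_seminorm (V : normedModType K) : is_seminorm (fun v : V => `|v|).
Proof. by split => [//|v w|k v]; [exact: ler_normD|exact: normrZ]. Qed.

(** Rescale $v$ by $d/(q(v)+t)$ to bring it into the region where $h\le M$, then let $t\to 0$; the
    positive $t$ is there because $q(v)$ may vanish. *)
Lemma homogeneous_bound (V : lmodType K) (q h : V -> K) (d M : K) :
  is_seminorm q -> (forall (k : K) v, h (k *: v) = `|k| * h v) ->
  0 < d -> 0 <= M -> (forall v, q v < d -> h v <= M) ->
  forall v, h v <= M / d * q v.
Proof.
move=> [q0 _ qZ] hZ d0 M0 hM v.
have Md : 0 <= M / d by rewrite divr_ge0// ltW.
apply: (small_le Md) => t t0; rewrite -mulrDr.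
have s0 : 0 < q v + t by rewrite ltr_wpDl.
have ds0 : 0 < d / (q v + t) by rewrite divr_gt0.
have := hM ((d / (q v + t)) *: v); rewrite qZ hZ (gtr0_norm ds0).
rewrite mulrAC ltr_pdivrMr// ltr_pM2l// ltrDl t0 => /(_ isT).
by rewrite -ler_pdivlMl// invf_div mulrAC [_ * M]mulrC [M * _ / _]mulrAC.
Qed.

Definition linear_map (V W : lmodType K) (f : V -> W) : Prop :=
  forall (k : K) x y, f (k *: x + y) = k *: f x + f y.

Section LinearMap.
Variables (V W : lmodType K) (f : V -> W).
Hypothesis lf : linear_map f.

Lemma linear_mapD x y : f (x + y) = f x + f y.
Proof. by rewrite -(scale1r x) lf !scale1r. Qed.

Lemma linear_map0 : f 0 = 0.
Proof. by apply: (addIr (f 0)); rewrite -linear_mapD !add0r. Qed.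

Lemma linear_mapZ k x : f (k *: x) = k *: f x.
Proof. by rewrite -(addr0 (k *: x)) lf linear_map0 addr0. Qed.

Lemma linear_mapB x y : f (x - y) = f x - f y.
Proof. by rewrite -scaleN1r linear_mapD linear_mapZ scaleN1r. Qed.

End LinearMap.

Definition bilinear_map (V X Y : lmodType K) (f : V -> X -> Y) : Prop :=
  (forall x, linear_map (f^~ x)) /\ (forall v, linear_map (f v)).

(** The gauge [q] is left arbitrary so that one notion serves seminorms on bare vector spaces,
    norms, and the absolute value of [K]. *)
Definition seq_cauchy (V : zmodType) (q : V -> K) (u : nat -> V) : Prop :=
  forall e, 0 < e -> exists N, forall i j, (N <= i)%N -> (N <= j)%N ->
    q (u i - u j) < e.

Definition seq_lim (V : zmodType) (q : V -> K) (u : nat -> V) (l : V) : Prop :=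
  forall e, 0 < e -> exists N, forall i, (N <= i)%N -> q (u i - l) < e.

Definition seq_complete (V : zmodType) (q : V -> K) : Prop :=
  forall u, seq_cauchy q u -> exists l, seq_lim q u l.

Lemma complete_seq_complete (E : completeNormedModType K) :
  seq_complete (fun x : E => `|x|).
Proof.
move=> u cu.
have : cvg (u @ \oo)%classic.
  apply/cauchy_cvgP/cauchy_exP => e e0.
  have [N hN] := cu e e0; exists (u N); exists N => // i /= Ni.
  by rewrite -ball_normE /= hN.
move=> /cvg_ex[l /cvgrPdistC_lt ul]; exists l => e /ul[N _ hN].
by exists N => i Ni; exact: hN.
Qed.

(** A general numeric field may be non-Archimedean; this makes the radii $1/(n+1)$ tend to 0. *)
Hypothesis archi : forall e : K, 0 < e -> exists n : nat, n.+1%:R^-1 < e.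

Lemma nat_bound (x : K) : 0 <= x -> exists n, x <= n%:R.
Proof.
move=> x0; have x1 : 0 < x + 1 by rewrite ltr_wpDl.
have [|n hn] := archi (e := (x + 1)^-1); first by rewrite invr_gt0.
exists n.+1; apply: (@le_trans _ _ (x + 1)); first by rewrite lerDl.
by rewrite ltW// -ltf_pV2 ?posrE.
Qed.

Lemma seq_cauchy_of_bound (V : zmodType) (q : V -> K) (M : K) (u : nat -> V) :
  0 <= M ->
  (forall i j, q (u i - u j) <= M * (i.+1%:R^-1 + j.+1%:R^-1)) ->
  seq_cauchy q u.
Proof.
move=> M0 hu e e0; have M1 : 0 < M + M + 1 by rewrite ltr_wpDl// addr_ge0.
have [|N hN] := archi (e := e / (M + M + 1)); first by rewrite divr_gt0.
exists N => i j Ni Nj; apply: le_lt_trans (hu i j) _.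
have small k : (N <= k)%N -> k.+1%:R^-1 <= N.+1%:R^-1 :> K.
  by move=> Nk; rewrite lef_pV2 ?posrE// ler_nat.
apply: (@le_lt_trans _ _ ((M + M) * N.+1%:R^-1)).
  by rewrite mulrDl -mulrDr ler_wpM2l// lerD// small.
move: hN; rewrite ltr_pdivlMr// mulrC; apply: le_lt_trans.
by rewrite ler_pM2r// lerDl.
Qed.

(* Baire's theorem for a countable cover by closed sets, by nested balls. *)
Lemma closed_cover_ball (E : completeNormedModType K) (F : nat -> E -> Prop) :
  (forall n x, ~ F n x ->
     exists2 r, 0 < r & forall y, `|x - y| < r -> ~ F n y) ->
  (forall x, exists n, F n x) ->
  exists n x, exists2 r, 0 < r & forall y, `|x - y| < r -> F n y.
Proof.
move=> Fcl Fcov; apply: contrapT => nball.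
have escape n x r : 0 < r -> exists2 y, `|x - y| < r & ~ F n y.
  move=> r0; apply: contrapT => hF; apply: nball; exists n, x, r => // y xy.
  by apply: contrapT => nF; apply: hF; exists y.
(* From stage $n$ and a ball, produce a smaller closed ball that misses $F_n$. Positivity of the
   radius is a premise inside the existential so that choice yields a total function; [(0, 0)] is
   the default value. *)
have step (t : nat * (E * K)) : exists t' : E * K, 0 < t.2.2 ->
    [/\ 0 < t'.2, t'.2 <= t.1.+1%:R^-1 &
     forall z, `|t'.1 - z| <= t'.2 -> `|t.2.1 - z| <= t.2.2 /\ ~ F t.1 z].
  case: t => n [x r] /=; have [r0|] := pselect (0 < r); last by exists (0, 0).
  have [y xy nFy] := escape n x r r0.
  have [s s0 hs] := Fcl n y nFy.
  (* The new radius stays inside the old ball, keeps the closed ball within the open ball of radius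
     $s$, and is at most $1/(n+1)$ so that the centres form a Cauchy sequence. *)
  have [||a [a0 ar as_]] := pos_lower_bound (a := r - `|x - y|) (b := s / 2).
  - by rewrite subr_gt0.
  - by rewrite divr_gt0.
  have [||b [b0 ba bn]] := pos_lower_bound (a := a) (b := n.+1%:R^-1);
    rewrite ?invr_gt0//.
  exists (y, b) => _; split => // z /= yz; split.
    apply: le_trans (ler_distD y x z) _.
    by rewrite -lerBrDl (le_trans yz)// (le_trans ba).
  apply: hs; apply: le_lt_trans yz _; apply: le_lt_trans (le_trans ba as_) _.
  by rewrite ltr_pdivrMr// mulr_natr mulr2n ltrDl.
have [g hg] := boolp.choice step.
(* The balls start from the unit ball; the ball of index $n+1$ is the one that misses $F_n$. *)
pose t := fix t n := if n is m.+1 then g (m, t m) else ((0 : E), (1 : K)).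
have t0 n : 0 < (t n).2.
  elim: n => [|n IH]; first exact: ltr01.
  by have [] := hg (n, t n) IH.
have tS n : (t n.+1).2 <= n.+1%:R^-1 by have [] := hg (n, t n) (t0 n).
have tsub n z : `|(t n.+1).1 - z| <= (t n.+1).2 ->
    `|(t n).1 - z| <= (t n).2 /\ ~ F n z.
  by have [_ _] := hg (n, t n) (t0 n); apply.
have nested n m z : `|(t (n + m)%N).1 - z| <= (t (n + m)%N).2 ->
    `|(t n).1 - z| <= (t n).2.
  by elim: m z => [|m IH] z; rewrite ?addn0// addnS => /tsub[/IH].
have close n m : (n <= m)%N -> `|(t n).1 - (t m).1| <= (t n).2.
  move=> nm; apply: (nested n (m - n)%N); rewrite subnKC//.
  by rewrite subrr normr0 ltW.
have [l hl] : exists l, seq_lim (fun x : E => `|x|) (fun n => (t n.+1).1) l.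
  apply/complete_seq_complete/(@seq_cauchy_of_bound _ _ 1) => // i j.
  rewrite mul1r; have [ij|/ltnW ij] := leqP i j.
    apply: le_trans (close _ _ _) _; first by [].
    by apply: le_trans (tS i) _; rewrite lerDl.
  rewrite distrC; apply: le_trans (close _ _ _) _; first by [].
  by apply: le_trans (tS j) _; rewrite lerDr.
have tl n : `|(t n).1 - l| <= (t n).2.
  apply/ler_addgt0Pr => e e0; have [N hN] := hl e e0.
  apply: le_trans (ler_distD (t (maxn n N).+1).1 _ _) _.
  apply: lerD; first by apply: close; rewrite leqW// leq_maxl.
  by rewrite ltW// hN// leq_maxr.
have [n] := Fcov l.
by have [_] := tsub n l (tl n.+1).
Qed.

End Scalars.

(** * Boundedness of continuous linear maps and of separately continuous bilinear maps *)

Section BoundedMaps.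
Variable K : numFieldType.

Lemma seminorms_le (V : lmodType K) (q : nat -> V -> K) :
  (forall n v, q n v <= q n.+1 v) ->
  forall n m v, (n <= m)%N -> q n v <= q m v.
Proof.
move=> qS n m v /subnKC <-; elim: (m - n)%N => [|k IH]; first by rewrite addn0.
by rewrite addnS (le_trans IH).
Qed.

(** Continuity at 0 with tolerance 1 involves a single seminorm; homogeneity makes the resulting
    bound global. *)
Lemma sn_continuous_bound (V : lmodType K) (q : nat -> V -> K)
    (W : normedModType K) (f : V -> W) :
  (forall n, is_seminorm (q n)) -> linear_map f -> sn_continuous q f ->
  exists n, exists2 C, 0 <= C & forall v, `|f v| <= C * q n v.
Proof.
move=> sq lf /(_ 0 1 ltr01)[n [d d0 hd]]; exists n, (1 / d).
  by rewrite divr_ge0// ltW.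
apply: (@homogeneous_bound _ _ _ (fun v => `|f v|)) => //.
  by move=> k v; rewrite (linear_mapZ lf) normrZ.
by move=> v qv; have := hd v; rewrite (linear_map0 lf) !subr0 => /(_ qv)/ltW.
Qed.

Lemma continuous_sn_continuous (V W : normedModType K) (f : V -> W) :
  continuous f -> sn_continuous (@norm_family K V) f.
Proof.
move=> cf a e e0; exists 0%N.
have /cvgrPdistC_lt/(_ e e0) := cf a.
rewrite -nbhs_nbhs_norm => -[d d0 hd]; exists d => // b ab.
by apply: hd; rewrite /ball_ /= distrC.
Qed.

Lemma continuous_bound (V W : normedModType K) (f : V -> W) :
  linear_map f -> continuous f ->
  exists2 C, 0 <= C & forall v, `|f v| <= C * `|v|.
Proof.
move=> lf /continuous_sn_continuous cf.
have sn n : is_seminorm (@norm_family K V n) by exact: norm_seminorm.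
by have [n [C C0 hC]] := sn_continuous_bound sn lf cf; exists C.
Qed.

Lemma bound_continuous (V W : normedModType K) (f : V -> W) C :
  linear_map f -> 0 <= C -> (forall v, `|f v| <= C * `|v|) -> continuous f.
Proof.
move=> lf C0 hC a; apply/cvgrPdistC_lt => e e0.
have C1 : 0 < C + 1 by rewrite ltr_wpDl.
apply/nbhs_normP; exists (e / (C + 1)) => [|b]; first by rewrite /= divr_gt0.
rewrite /ball_ /= distrC => hb.
rewrite -(linear_mapB lf); apply: le_lt_trans (hC _) _.
move: hb; rewrite ltr_pdivlMr// mulrC mulrDl mul1r; apply: le_lt_trans.
by rewrite lerDl.
Qed.

Hypothesis archi : forall e : K, 0 < e -> exists n : nat, n.+1%:R^-1 < e.

(* Applying Baire's theorem in [X] rather than in [V] bypasses the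
   completeness of [V]. *)
Lemma separately_continuous_bound (V : lmodType K) (q : nat -> V -> K)
    (X : completeNormedModType K) (Y : normedModType K) (f : V -> X -> Y) :
  (forall n, is_seminorm (q n)) -> (forall n v, q n v <= q n.+1 v) ->
  bilinear_map f ->
  (forall v, continuous (f v)) -> (forall x, sn_continuous q (f^~ x)) ->
  exists n, exists2 C, 0 <= C & forall v x, `|f v x| <= C * q n v * `|x|.
Proof.
move=> sq qS [fl fr] cf snf.
have q0 n v : 0 <= q n v by case: (sq n).
(* A single $n$ is both the constant and the index of the seminorm, so that the cover is
   countable. *)
pose F n x := forall v, `|f v x| <= n%:R * q n v.
have [n [x [r r0 hr]]] : exists n x, exists2 r, 0 < r &
    forall y, `|x - y| < r -> F n y.
  apply: (closed_cover_ball archi) => [n x /existsNP[v /negP]|x].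
    rewrite -real_ltNge ?ger0_real ?mulr_ge0// => hv.
    (* The gap by which the inequality fails at $x$ is the tolerance within which it still fails
       nearby. *)
    have /cvgrPdist_lt/(_ (`|f v x| - n%:R * q n v)) := cf v x.
    rewrite subr_gt0 => /(_ hv); rewrite -nbhs_nbhs_norm => -[r r0 hr].
    exists r => // y xy /(_ v); apply/negP.
    rewrite -real_ltNge ?ger0_real ?mulr_ge0//.
    have := le_lt_trans (lerB_dist _ _) (hr y xy).
    by rewrite ltrD2l ltrN2.
  have [n [C C0 hC]] := sn_continuous_bound sq (fl x) (snf x).
  have [m Cm] := nat_bound archi C0.
  exists (maxn n m) => v; apply: le_trans (hC v) _; apply: ler_pM => //.
    by rewrite (le_trans Cm)// ler_nat leq_maxr.
  by rewrite seminorms_le// leq_maxl.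
exists n, ((n%:R + n%:R) / r) => [|v y].
  by rewrite divr_ge0 ?addr_ge0 ?ler0n// ltW.
rewrite [_ / r * _]mulrAC mulrDl.
apply: (@homogeneous_bound _ _ (fun x : X => `|x|) (fun y => `|f v y|)) => //.
- exact: norm_seminorm.
- by move=> k z; rewrite (linear_mapZ (fr v)) normrZ.
- by rewrite addr_ge0// mulr_ge0.
(* Here $z=(x+z)-x$ is a difference of two points of the ball, whence the factor $n+n$. *)
move=> z hz; rewrite -(addrK x z) [z + x]addrC (linear_mapB (fr v)).
apply: le_trans (ler_normB _ _) _; apply: lerD; apply: hr.
  by rewrite opprD addNKr normrN.
by rewrite subrr normr0.
Qed.

End BoundedMaps.

(** * Extension of bounded maps from a dense image *)

Section DenseExtension.
Variables (K : numFieldType) (V : lmodType K) (B : normedModType K).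
Variable phi : V -> B.
Hypothesis lphi : linear_map phi.
Hypothesis dphi : forall (y : B) (e : K), 0 < e -> exists a, `|y - phi a| < e.

Definition bounded_linear (W X : normedModType K) (f : W -> X) : Prop :=
  linear_map f /\ exists2 C, 0 <= C & forall w, `|f w| <= C * `|w|.

(** The value of $f-g$ at $y$ equals its value at $y-\varphi(a)$, which is arbitrarily small by
    density. *)
Lemma dense_ext (X : normedModType K) (f g : B -> X) :
  bounded_linear f -> bounded_linear g ->
  (forall a, f (phi a) = g (phi a)) -> forall y, f y = g y.
Proof.
move=> [lf [C C0 hC]] [lg [M M0 hM]] fg y; apply/eqP; rewrite -subr_eq0.
apply/eqP; apply: (@small_norm _ _ _ (C + M)); first exact: addr_ge0.
move=> d d0; have [a /ltW ya] := dphi y d0.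
have -> : f y - g y = f (y - phi a) - g (y - phi a).
  by rewrite (linear_mapB lf) (linear_mapB lg) fg opprB addrA subrK.
rewrite mulrDl; apply: le_trans (ler_normB _ _) _.
by apply: lerD; [apply: le_trans (hC _) _|apply: le_trans (hM _) _];
  rewrite ler_wpM2l.
Qed.

Hypothesis archi : forall e : K, 0 < e -> exists n : nat, n.+1%:R^-1 < e.

(** For fixed $x$ the map $a\mapsto f(a,x)$ is Lipschitz in $\varphi(a)$, hence extends to the
    complete target. Only the first variable is extended, so a second application handles the other
    one. *)
Lemma bilinear_extension (X : lmodType K) (q : X -> K) (Y : normedModType K)
    (f : V -> X -> Y) (C : K) :
  seq_complete (fun y : Y => `|y|) -> (forall x, 0 <= q x) ->
  bilinear_map f -> 0 <= C ->
  (forall a x, `|f a x| <= C * `|phi a| * q x) ->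
  exists F : B -> X -> Y, [/\ bilinear_map F,
    (forall a x, F (phi a) x = f a x) &
    forall y x, `|F y x| <= C * `|y| * q x].
Proof.
move=> cY q0 [fl fr] C0 hf.
have fB a b x : `|f a x - f b x| <= C * q x * `|phi a - phi b|.
  by rewrite -(linear_mapB (fl x)) -(linear_mapB lphi) mulrAC.
have Cq x : 0 <= C * q x by exact: mulr_ge0.
(* [F y x] is the point whose distance to [f a x] is controlled by the
   distance of [phi a] to [y]. *)
have exF y x : exists z, forall a, `|f a x - z| <= C * q x * `|phi a - y|.
  have /boolp.choice[s hs] : forall n : nat,
      exists a, `|y - phi a| < n.+1%:R^-1.
    by move=> n; apply: dphi; rewrite invr_gt0.
  have [z hz] : exists z, seq_lim (fun y : Y => `|y|) (fun n => f (s n) x) z.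
    apply/cY/(@seq_cauchy_of_bound _ archi _ _ (C * q x)) => // i j.
    apply: le_trans (fB _ _ _) _; apply: ler_wpM2l => //.
    apply: le_trans (ler_distD y _ _) _; apply: lerD; last exact/ltW/hs.
    by rewrite distrC; apply/ltW/hs.
  exists z => a; apply: (@small_le _ _ _ (C * q x + 1)).
    by rewrite addr_ge0.
  move=> d d0; have [N hN] := hz d d0.
  have [M hM] := archi d0.
  pose n := maxn N M; have Nn : (N <= n)%N by rewrite leq_maxl.
  have sn : `|y - phi (s n)| <= d.
    apply: le_trans (ltW (hs n)) _; apply: le_trans (ltW hM).
    by rewrite lef_pV2 ?posrE// ler_nat ltnS leq_maxr.
  apply: le_trans (ler_distD (f (s n) x) _ _) _.
  rewrite [(_ + 1) * d]mulrDl mul1r addrA; apply: lerD; last exact/ltW/hN.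
  apply: le_trans (fB _ _ _) _; rewrite -mulrDr; apply: ler_wpM2l => //.
  by apply: le_trans (ler_distD y _ _) _; rewrite lerD2l.
have /boolp.choice[F hF] : forall yx : B * X, exists z,
    forall a, `|f a yx.2 - z| <= C * q yx.2 * `|phi a - yx.1|.
  by case.
have {}hF y x a : `|f a x - F (y, x)| <= C * q x * `|phi a - y|.
  exact: (hF (y, x)).
(* Linearity is inherited from [f] at approximants. The estimate [hF] also gives the value at
   $\varphi(a)$, where the distance is 0, and the norm bound, by taking $a=0$. *)
exists (fun y x => F (y, x)); split.
- split=> [x k y y'|y k x x']; apply/eqP; rewrite -subr_eq0; apply/eqP.
    apply: (@small_norm _ _ _ (C * q x * (`|k| + 1) + C * q x * (`|k| + 1))).
      by rewrite addr_ge0// mulr_ge0// addr_ge0.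
    move=> d d0; have [a ya] := dphi y d0; have [a' ya'] := dphi y' d0.
    rewrite distrC in ya; rewrite distrC in ya'.
    rewrite mulrDl; apply: le_trans (ler_distD (f (k *: a + a') x) _ _) _.
    have e1 : `|k| * `|phi a - y| + `|phi a' - y'| <= (`|k| + 1) * d.
      by rewrite mulrDl mul1r; apply: lerD; [apply: ler_wpM2l|]; rewrite // ltW.
    apply: lerD.
      rewrite distrC; apply: le_trans (hF _ _ _) _; rewrite -[leRHS]mulrA.
      apply: ler_wpM2l => //; apply: le_trans e1.
      rewrite lphi opprD addrACA -scalerBr -normrZ.
      exact: ler_normD.
    rewrite fl opprD addrACA -scalerBr; apply: le_trans (ler_normD _ _) _.
    rewrite normrZ -[leRHS]mulrA; apply: le_trans (ler_wpM2l (Cq x) e1).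
    rewrite mulrDr mulrCA; apply: lerD; last exact: hF.
    by apply: ler_wpM2l => //; exact: hF.
  apply: (@small_norm _ _ _
    (C * q (k *: x + x') + (`|k| * (C * q x) + C * q x'))).
    by rewrite !addr_ge0// mulr_ge0.
  move=> d d0; have [a /ltW ya] := dphi y d0; rewrite distrC in ya.
  rewrite !mulrDl; apply: le_trans (ler_distD (f a (k *: x + x')) _ _) _.
  apply: lerD.
    by rewrite distrC; apply: le_trans (hF _ _ _) _; apply: ler_wpM2l.
  rewrite fr opprD addrACA -scalerBr; apply: le_trans (ler_normD _ _) _.
  rewrite normrZ; apply: lerD.
    rewrite -[leRHS]mulrA; apply: ler_wpM2l => //; apply: le_trans (hF _ _ _) _.
    exact: ler_wpM2l.
  by apply: le_trans (hF _ _ _) _; apply: ler_wpM2l.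
- move=> a x; apply/esym/eqP; rewrite -subr_eq0 -normr_le0.
  by apply: le_trans (hF _ _ _) _; rewrite subrr normr0 mulr0.
- move=> y x; have := hF y x 0; rewrite (linear_map0 (fl x)) (linear_map0 lphi).
  by rewrite !sub0r !normrN mulrAC.
Qed.

End DenseExtension.

(** * Limits of nonnegative scalars and completeness through sequences *)

Section ScalarLimits.
Local Open Scope classical_set_scope.
Variable K : numFieldType.

(** Under a partial order the negation of $0\le l$ does not give $l<0$; instead $|l|=l$ is proved,
    since $|s_i|=s_i$ tends to both. *)
Lemma seq_lim_ge0 (s : nat -> K) (l : K) :
  (forall i, 0 <= s i) -> seq_lim (fun x : K => `|x|) s l -> 0 <= l.
Proof.
move=> s0 sl; suff /eqP : `|l| - l = 0.
  by rewrite subr_eq0 eq_sym => /eqP ->.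
apply/eqP; rewrite -normr_le0; apply: (@small_le _ _ _ (1 + 1)) => // d d0.
have [N /(_ N (leqnn N))/ltW hN] := sl d d0.
rewrite add0r mulrDl mul1r; apply: le_trans (ler_distD (s N) _ _) _.
apply: lerD => //; rewrite -[X in `|_ - X|]ger0_norm//.
by apply: le_trans (ler_dist_dist _ _) _; rewrite distrC.
Qed.

Lemma ge0_dist_lt (s l e : K) : 0 <= s -> 0 <= l -> `|s - l| < e ->
  s <= l + e /\ l <= s + e.
Proof.
move=> s0 l0 /ltW sle; rewrite -!lerBlDl; split; apply: le_trans sle.
  by apply: real_ler_norm; rewrite rpredB// ger0_real.
by rewrite distrC; apply: real_ler_norm; rewrite rpredB// ger0_real.
Qed.

(** A Cauchy filter contains balls of radius $1/(n+1)$; their centres form a Cauchy sequence whose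
    limit is the limit of the filter. *)
Lemma seq_complete_cvg (E : normedModType K) :
  (forall e : K, 0 < e -> exists n : nat, n.+1%:R^-1 < e) ->
  seq_complete (fun x : E => `|x|) ->
  forall F : set_system E, ProperFilter F -> cauchy F -> cvg F.
Proof.
move=> archi cE F PF /cauchyP Fc.
have /boolp.choice[y Fy] :
    forall n : nat, exists y : E, F (ball y (n.+1%:R^-1 : K)).
  by move=> n; apply: Fc; rewrite invr_gt0.
have [l hl] : exists l, seq_lim (fun x : E => `|x|) y l.
  apply/cE/(@seq_cauchy_of_bound _ archi _ _ 1) => // i j.
  have [z []] := filter_ex (filterI (Fy i) (Fy j)).
  rewrite -ball_normE /= => yi yj; rewrite mul1r.
  apply: le_trans (ler_distD z _ _) _.
  by apply: lerD; rewrite ltW// distrC.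
apply/cvg_ex; exists l; apply/fcvgrPdist_lt => e e0.
have e20 : 0 < e / 2 by rewrite divr_gt0.
have [M hM] := archi _ e20; have [N hN] := hl _ e20.
pose n := maxn M N; apply: filterS (Fy n) => z; rewrite -ball_normE /= => yz.
apply: le_lt_trans (ler_distD (y n) _ _) _; rewrite [ltRHS]splitr.
apply: ltrD; first by rewrite distrC hN// leq_maxr.
apply: lt_le_trans yz _; apply: le_trans (ltW hM).
by rewrite lef_pV2 ?posrE// ler_nat ltnS leq_maxl.
Qed.

End ScalarLimits.

(** * The completion of a seminormed space: Cauchy sequences modulo null sequences *)

Section Completion.
Local Open Scope quotient_scope.
Variables (K : numFieldType) (V : lmodType K) (p : V -> K).
Hypothesis hp : is_seminorm p.
Hypothesis archi : forall e : K, 0 < e -> exists n : nat, n.+1%:R^-1 < e.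
Hypothesis cK : seq_complete (fun x : K => `|x|).

Record cauchy_seq := CauchySeq
  { cauchy_val :> nat -> V; cauchy_valP : seq_cauchy p cauchy_val }.

HB.instance Definition _ := gen_eqMixin cauchy_seq.
HB.instance Definition _ := gen_choiceMixin cauchy_seq.

Definition cauchy_equiv (u v : cauchy_seq) : bool :=
  `[< seq_lim p (fun i => u i - v i) 0 >].

Lemma cauchy_equiv_refl : reflexive cauchy_equiv.
Proof.
move=> u; apply/asboolP => e e0; exists 0%N => i _.
by rewrite subrr subr0 seminorm0.
Qed.

Lemma cauchy_equiv_sym : symmetric cauchy_equiv.
Proof.
move=> u v; apply/asboolP/asboolP => h e /h[N hN]; exists N => i /hN.
  by rewrite !subr0 seminorm_distC.
by rewrite !subr0 seminorm_distC.
Qed.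

Lemma cauchy_equiv_trans : transitive cauchy_equiv.
Proof.
move=> v u w /asboolP uv /asboolP vw; apply/asboolP => e e0.
have e20 : 0 < e / 2 by rewrite divr_gt0.
have [N hN] := uv _ e20; have [M hM] := vw _ e20.
exists (maxn N M) => i; rewrite geq_max => /andP[/hN + /hM].
rewrite !subr0 => h1 h2; rewrite [ltRHS]splitr.
by apply: le_lt_trans (seminorm_distD (v i) _ _ hp) _; apply: ltrD.
Qed.

Canonical cauchy_equiv_equiv :=
  EquivRel cauchy_equiv cauchy_equiv_refl cauchy_equiv_sym cauchy_equiv_trans.

Definition completion_carrier := {eq_quot cauchy_equiv}.

End Completion.

(* [archi] and [cK] are parameters only because the canonical instances below
   need them: the existence of the norm and completeness depend on them. *)
Definition completion (K : numFieldType) (V : lmodType K) (p : V -> K)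
  (hp : is_seminorm p)
  (archi : forall e : K, 0 < e -> exists n : nat, n.+1%:R^-1 < e)
  (cK : seq_complete (fun x : K => `|x|)) := completion_carrier hp.

(** * Linear structure, norm and completeness of the completion *)

Section CompletionTheory.
Local Open Scope classical_set_scope.
Local Open Scope quotient_scope.
Variables (K : numFieldType) (V : lmodType K) (p : V -> K).
Hypothesis hp : is_seminorm p.
Hypothesis archi : forall e : K, 0 < e -> exists n : nat, n.+1%:R^-1 < e.
Hypothesis cK : seq_complete (fun x : K => `|x|).

Local Notation T := (completion hp archi cK).
Local Notation cauchy_seq := (cauchy_seq p).

HB.instance Definition _ := Choice.copy T {eq_quot cauchy_equiv_equiv hp}.

Definition class (u : cauchy_seq) : T :=
  \pi_({eq_quot cauchy_equiv_equiv hp}) u.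

Definition class_repr (x : T) : cauchy_seq :=
  repr (x : {eq_quot cauchy_equiv_equiv hp}).

Lemma class_reprK x : class (class_repr x) = x.
Proof. exact: reprK. Qed.

Lemma class_eq u v : class u = class v <-> seq_lim p (fun i => u i - v i) 0.
Proof.
split=> [/eqmodP/asboolP //|h].
by apply/eqmodP/asboolP.
Qed.

Lemma class_ext (u v : cauchy_seq) : (forall i, u i = v i) -> class u = class v.
Proof.
move=> uv; apply/class_eq => e e0; exists 0%N => i _.
by rewrite uv subrr subr0 seminorm0.
Qed.

Lemma const_cauchy a : seq_cauchy p (fun=> a).
Proof. by move=> e e0; exists 0%N => i j _ _; rewrite subrr seminorm0. Qed.

Definition const_seq a := CauchySeq (const_cauchy a).

Lemma comb_lt (k : K) (v w : V) (e : K) : 0 < e ->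
  p v < e / 2 / (`|k| + 1) -> p w < e / 2 -> p (k *: v + w) < e.
Proof.
case: hp => p0 pD pZ e0; have k1 : 0 < `|k| + 1 by rewrite ltr_wpDl.
move=> + hw; rewrite ltr_pdivlMr// mulrDr mulr1 => hv.
apply: le_lt_trans (pD _ _) _; rewrite pZ [ltRHS]splitr; apply: ltrD => //.
by apply: le_lt_trans hv; rewrite mulrC lerDl.
Qed.

Lemma comb_cauchy (k : K) (u v : cauchy_seq) :
  seq_cauchy p (fun i => k *: u i + v i).
Proof.
move=> e e0; have k1 : 0 < `|k| + 1 by rewrite ltr_wpDl.
have [|N hN] := @cauchy_valP _ _ _ u (e / 2 / (`|k| + 1)).
  by rewrite !divr_gt0.
have [|M hM] := @cauchy_valP _ _ _ v (e / 2).
  by rewrite divr_gt0.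
exists (maxn N M) => i j; rewrite !geq_max => /andP[Ni Mi] /andP[Nj Mj].
rewrite opprD addrACA -scalerBr; apply: comb_lt => //; first exact: hN.
exact: hM.
Qed.

(** Sum, scaling and opposite are all instances of $ku+v$, so compatibility with the equivalence is
    proved once. *)
Definition comb_seq k u v := CauchySeq (comb_cauchy k u v).

Lemma class_comb k u u' v v' : class u = class u' -> class v = class v' ->
  class (comb_seq k u v) = class (comb_seq k u' v').
Proof.
move=> /class_eq uu' /class_eq vv'; apply/class_eq => e e0.
have k1 : 0 < `|k| + 1 by rewrite ltr_wpDl.
have [|N hN] := uu' (e / 2 / (`|k| + 1)); first by rewrite !divr_gt0.
have [|M hM] := vv' (e / 2); first by rewrite divr_gt0.
exists (maxn N M) => i; rewrite geq_max => /andP[/hN + /hM].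
rewrite !subr0 => h1 h2 /=.
by rewrite opprD addrACA -scalerBr; apply: comb_lt.
Qed.

Definition czero : T := class (const_seq 0).
Definition cscale k (x : T) : T :=
  class (comb_seq k (class_repr x) (const_seq 0)).
Definition cadd (x y : T) : T :=
  class (comb_seq 1 (class_repr x) (class_repr y)).

Lemma caddE u v : cadd (class u) (class v) = class (comb_seq 1 u v).
Proof. by apply: class_comb; rewrite class_reprK. Qed.

Lemma cscaleE k u : cscale k (class u) = class (comb_seq k u (const_seq 0)).
Proof. by apply: class_comb; rewrite ?class_reprK. Qed.

Lemma caddA : associative cadd.
Proof.
move=> x y z; rewrite -(class_reprK x) -(class_reprK y) -(class_reprK z).
by rewrite !caddE; apply: class_ext => i /=; rewrite !scale1r addrA.
Qed.

Lemma caddC : commutative cadd.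
Proof.
move=> x y; rewrite -(class_reprK x) -(class_reprK y) !caddE.
by apply: class_ext => i /=; rewrite !scale1r addrC.
Qed.

Lemma cadd0 : left_id czero cadd.
Proof.
move=> x; rewrite -(class_reprK x) caddE.
by apply: class_ext => i /=; rewrite scaler0 add0r.
Qed.

Lemma caddN : left_inverse czero (cscale (-1)) cadd.
Proof.
move=> x; rewrite -(class_reprK x) cscaleE caddE; apply: class_ext => i /=.
by rewrite scale1r scaleN1r addr0 addNr.
Qed.

HB.instance Definition _ := GRing.isZmodule.Build T caddA caddC cadd0 caddN.

Lemma cscaleA a b x : cscale a (cscale b x) = cscale (a * b) x.
Proof.
rewrite -(class_reprK x) !cscaleE; apply: class_ext => i /=.
by rewrite !addr0 scalerA.
Qed.

Lemma cscale1 : left_id 1 cscale.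
Proof.
move=> x; rewrite -(class_reprK x) !cscaleE; apply: class_ext => i /=.
by rewrite !addr0 scale1r.
Qed.

Lemma cscaleDr : right_distributive cscale +%R.
Proof.
move=> a x y; rewrite -(class_reprK x) -(class_reprK y).
rewrite [_ + _]caddE !cscaleE [RHS]caddE; apply: class_ext => i /=.
by rewrite !addr0 !scale1r scalerDr.
Qed.

Lemma cscaleDl x : {morph cscale^~ x : a b / a + b}.
Proof.
move=> a b; rewrite -(class_reprK x) !cscaleE [RHS]caddE.
by apply: class_ext => i /=; rewrite !addr0 !scale1r scalerDl.
Qed.

HB.instance Definition _ :=
  GRing.Zmodule_isLmodule.Build K T cscaleA cscale1 cscaleDr cscaleDl.

Lemma class_combE k u v : class (comb_seq k u v) = k *: class u + class v.
Proof.
rewrite [k *: _]cscaleE [RHS]caddE; apply: class_ext => i /=.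
by rewrite scale1r addr0.
Qed.

(** The limit of the seminorm along a chosen representative; the default 0 is never taken, as
    [cnormP] shows that the limit exists. *)
Definition cnorm (x : T) : K :=
  xget 0 [set l | seq_lim (fun x : K => `|x|) (fun i => p (class_repr x i)) l].

Lemma seminorm_dist v w : `|p v - p w| <= p (v - w).
Proof.
case: (hp) => p0 pD _; rewrite real_ler_norml ?rpredB ?ger0_real//.
rewrite lerNl opprB !lerBlDr; apply/andP; split.
  by rewrite -{1}(subrK v w) seminorm_distC.
by rewrite -{1}(subrK w v).
Qed.

(** By the reverse triangle inequality the values of [p] along a Cauchy sequence are Cauchy in the
    complete field [K], and equivalent sequences give the same limit. *)
Lemma cnormP (u : cauchy_seq) :
  seq_lim (fun x : K => `|x|) (fun i => p (u i)) (cnorm (class u)).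
Proof.
have [l hl] : exists l,
    seq_lim (fun x : K => `|x|) (fun i => p (class_repr (class u) i)) l.
  apply: cK => e e0.
  have [N hN] := @cauchy_valP _ _ _ (class_repr (class u)) e e0.
  exists N => i j Ni Nj; exact: le_lt_trans (seminorm_dist _ _) (hN i j Ni Nj).
have cl : seq_lim (fun x : K => `|x|) (fun i => p (class_repr (class u) i))
    (cnorm (class u)).
  exact: (xgetPex 0 (ex_intro _ l hl)).
have /class_eq uu : class u = class (class_repr (class u)).
  by rewrite class_reprK.
move=> e e0; have e20 : 0 < e / 2 by rewrite divr_gt0.
have [N hN] := uu _ e20; have [M hM] := cl _ e20.
exists (maxn N M) => i; rewrite geq_max => /andP[/hN + /hM].
rewrite subr0 => h1 h2.
rewrite [ltRHS]splitr.
apply: le_lt_trans (ler_distD (p (class_repr (class u) i)) _ _) _.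
by apply: ltrD => //; apply: le_lt_trans (seminorm_dist _ _) h1.
Qed.

Lemma cnorm_ge0 x : 0 <= cnorm x.
Proof.
rewrite -(class_reprK x); apply: seq_lim_ge0 (cnormP _) => i /=.
exact: seminorm_ge0.
Qed.

Lemma cnorm_near (u : cauchy_seq) e : 0 < e -> exists N, forall i, (N <= i)%N ->
  p (u i) <= cnorm (class u) + e /\ cnorm (class u) <= p (u i) + e.
Proof.
move=> e0; have [N hN] := cnormP u e0; exists N => i Ni.
by apply: ge0_dist_lt (hN i Ni); [exact: seminorm_ge0|exact: cnorm_ge0].
Qed.

(** The factor [M] lets callers add up several errors of size $e$ without rescaling $e$. *)
Lemma cnorm_le (u : cauchy_seq) M c : 0 <= M ->
  (forall e, 0 < e -> exists N, forall i, (N <= i)%N -> p (u i) <= c + M * e) ->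
  cnorm (class u) <= c.
Proof.
move=> M0 h; apply: (@small_le _ _ _ (M + 1)); first by rewrite addr_ge0.
move=> e e0; have [N hN] := h e e0; have [N' hN'] := cnorm_near u e0.
have [_] := hN' (maxn N N') (leq_maxr _ _); move/le_trans; apply.
by rewrite mulrDl mul1r addrA lerD2r hN// leq_maxl.
Qed.

Lemma cnormD x y : cnorm (x + y) <= cnorm x + cnorm y.
Proof.
rewrite -(class_reprK x) -(class_reprK y).
move: (class_repr x) (class_repr y) => u v.
rewrite [_ + _]caddE; apply: (@cnorm_le _ (1 + 1)) => // e e0.
have [N hN] := cnorm_near u e0; have [M hM] := cnorm_near v e0.
exists (maxn N M) => i; rewrite geq_max => /andP[/hN[h1 _] /hM[h2 _]] /=.
rewrite scale1r mulrDl mul1r addrACA; case: (hp) => _ pD _.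
by apply: le_trans (pD _ _) _; apply: lerD.
Qed.

Lemma cnormZ_le k x : cnorm (k *: x) <= `|k| * cnorm x.
Proof.
rewrite -(class_reprK x); move: (class_repr x) => u.
rewrite [k *: _]cscaleE; apply: (@cnorm_le _ `|k|) => // e e0.
have [N hN] := cnorm_near u e0; exists N => i /hN[h1 _] /=.
by rewrite addr0 -mulrDr; case: (hp) => _ _ ->; apply: ler_wpM2l.
Qed.

(** For $k\ne 0$ the reverse inequality is [cnormZ_le] applied to $x=k^{-1}(kx)$. *)
Lemma cnormZ k x : cnorm (k *: x) = `|k| * cnorm x.
Proof.
apply/le_anti; rewrite cnormZ_le /=; have [->|k0] := eqVneq k 0.
  by rewrite normr0 mul0r cnorm_ge0.
rewrite -{1}(scale1r x) -(mulVf k0) -scalerA.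
apply: le_trans (ler_wpM2l _ (cnormZ_le _ _)) _ => //.
by rewrite mulrA -normrM divff// normr1 mul1r.
Qed.

Lemma cnorm_eq0 x : cnorm x = 0 -> x = 0.
Proof.
rewrite -(class_reprK x) => x0; apply/class_eq => e e0.
have [N hN] := cnormP (class_repr x) e0; exists N => i /hN.
by rewrite /= x0 !subr0 ger0_norm// seminorm_ge0.
Qed.

HB.instance Definition _ := Lmodule_isNormed.Build K T cnormD cnormZ cnorm_eq0.

Definition embed (a : V) : T := class (const_seq a).

Lemma embed_linear : linear_map embed.
Proof.
by move=> k a b; rewrite /embed -class_combE; apply: class_ext.
Qed.

Lemma norm_class (u : cauchy_seq) c M : 0 <= M ->
  (forall e, 0 < e -> exists N, forall i, (N <= i)%N -> p (u i) <= c + M * e) ->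
  `|class u| <= c.
Proof. exact: cnorm_le. Qed.

Lemma norm_embed a : `|embed a| = p a.
Proof.
apply/le_anti/andP; split.
  apply: (@norm_class _ _ 0) => // e e0; exists 0%N => i _.
  by rewrite mul0r addr0.
apply: (@small_le _ _ _ 1) => // e e0; rewrite mul1r.
by have [N /(_ N (leqnn N))[]] := cnorm_near (const_seq a) e0.
Qed.

Lemma embed_approx (u : cauchy_seq) e : 0 < e ->
  exists N, forall i, (N <= i)%N -> `|class u - embed (u i)| <= e.
Proof.
move=> e0; have [N hN] := cauchy_valP u e0; exists N => i Ni.
rewrite addrC -scaleN1r /embed -class_combE.
apply: (@norm_class _ _ 0) => // d d0; exists N => j Nj /=.
by rewrite scaleN1r addrC mul0r addr0 ltW// hN.
Qed.

Lemma embed_dense (y : T) e : 0 < e -> exists a, `|y - embed a| < e.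
Proof.
move=> e0; have e20 : 0 < e / 2 by rewrite divr_gt0.
have [N /(_ N (leqnn N)) hN] := embed_approx (class_repr y) e20.
exists (class_repr y N); move: hN; rewrite class_reprK => /le_lt_trans; apply.
by rewrite [ltRHS]splitr ltrDl.
Qed.

(** Replace each $y_n$ by an embedded vector $a_n$ at distance below $1/(n+1)$. The embedding is
    isometric, so $(a_n)$ is Cauchy in [V], and its class is the limit of $(y_n)$. *)
Lemma completion_seq_complete : seq_complete (fun x : T => `|x|).
Proof.
move=> y cy.
have /boolp.choice[a ha] : forall n, exists a, `|y n - embed a| < n.+1%:R^-1.
  by move=> n; apply: embed_dense; rewrite invr_gt0.
have ya e : 0 < e -> exists N, forall i, (N <= i)%N -> `|y i - embed (a i)| < e.
  move=> /archi[N hN]; exists N => i Ni; apply: lt_trans (ha i) _.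
  by apply: le_lt_trans hN; rewrite lef_pV2 ?posrE// ler_nat.
have ca : seq_cauchy p a.
  move=> e e0; have e30 : 0 < e / 2 / 2 by rewrite !divr_gt0.
  have e20 : 0 < e / 2 by rewrite divr_gt0.
  have [N hN] := ya _ e30; have [M hM] := cy _ e20.
  exists (maxn N M) => i j; rewrite !geq_max => /andP[Ni Mi] /andP[Nj Mj].
  rewrite -norm_embed (linear_mapB embed_linear) [ltRHS]splitr.
  apply: le_lt_trans (ler_distD (y i) _ _) _.
  rewrite {1}[e / 2]splitr -addrA; apply: ltrD; first by rewrite distrC hN.
  apply: le_lt_trans (ler_distD (y j) _ _) _; rewrite [ltRHS]addrC.
  by apply: ltrD; [exact: hM|exact: hN].
exists (class (CauchySeq ca)) => e e0.
have e20 : 0 < e / 2 by rewrite divr_gt0.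
have [N hN] := ya _ e20; have [M hM] := embed_approx (CauchySeq ca) e20.
exists (maxn N M) => i; rewrite geq_max => /andP[Ni Mi].
apply: le_lt_trans (ler_distD (embed (a i)) _ _) _; rewrite [ltRHS]splitr.
by apply: ltr_leD; [exact: hN|rewrite distrC; exact: hM].
Qed.

HB.instance Definition _ := Uniform_isComplete.Build T
  (seq_complete_cvg archi completion_seq_complete).

Definition completion_completeNormedModType : completeNormedModType K := T.

End CompletionTheory.

(** * Calculus of bounded linear and bilinear maps, and bounds for derivations *)

Section BoundedLinear.
Variable K : numFieldType.

Lemma bounded_linear_comp (U V W : normedModType K) (g : V -> W) (f : U -> V) :
  bounded_linear g -> bounded_linear f -> bounded_linear (fun x => g (f x)).
Proof.
move=> [lg [C C0 hC]] [lf [M M0 hM]]; split=> [k x y|]; first by rewrite lf lg.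
exists (C * M) => [|x]; first exact: mulr_ge0.
by apply: le_trans (hC _) _; rewrite -mulrA; apply: ler_wpM2l.
Qed.

Lemma bounded_linearD (V W : normedModType K) (f g : V -> W) :
  bounded_linear f -> bounded_linear g -> bounded_linear (fun x => f x + g x).
Proof.
move=> [lf [C C0 hC]] [lg [M M0 hM]]; split=> [k x y|].
  by rewrite lf lg scalerDr addrACA.
exists (C + M) => [|x]; first exact: addr_ge0.
by rewrite mulrDl; apply: le_trans (ler_normD _ _) _; apply: lerD.
Qed.

Lemma bounded_linearN (V W : normedModType K) (f : V -> W) :
  bounded_linear f -> bounded_linear (fun x => - f x).
Proof.
move=> [lf [C C0 hC]]; split=> [k x y|]; first by rewrite lf opprD scalerN.
by exists C => // x; rewrite normrN.
Qed.

Lemma bounded_linearB (V W : normedModType K) (f g : V -> W) :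
  bounded_linear f -> bounded_linear g -> bounded_linear (fun x => f x - g x).
Proof. by move=> hf hg; apply/bounded_linearD/bounded_linearN. Qed.

Lemma bounded_linear_continuous (V W : normedModType K) (f : V -> W) :
  bounded_linear f -> continuous f.
Proof. by move=> [lf [C C0 hC]]; apply: bound_continuous lf C0 hC. Qed.

Lemma bounded_linear_sn_continuous (V W : normedModType K) (f : V -> W) :
  bounded_linear f -> sn_continuous (@norm_family K V) f.
Proof. by move/bounded_linear_continuous/continuous_sn_continuous. Qed.

Lemma sn_continuous_bounded_linear (V W : normedModType K) (f : V -> W) :
  linear_map f -> sn_continuous (@norm_family K V) f -> bounded_linear f.
Proof.
move=> lf cf.
have sn n : is_seminorm (@norm_family K V n) by exact: norm_seminorm.
by have [n [C C0 hC]] := sn_continuous_bound sn lf cf; split=> //; exists C.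
Qed.

Definition bounded_bilinear (U V W : normedModType K) (f : U -> V -> W)
  : Prop :=
  bilinear_map f /\ exists2 C, 0 <= C & forall x y, `|f x y| <= C * `|x| * `|y|.

Section BoundedBilinear.
Variables (U V W : normedModType K) (f : U -> V -> W).
Hypothesis hf : bounded_bilinear f.

Lemma bounded_bilinear_l y : bounded_linear (f^~ y).
Proof.
case: hf => -[lf _] [C C0 hC]; split; first exact: lf.
exists (C * `|y|) => [|x]; first exact: mulr_ge0.
by rewrite mulrAC.
Qed.

Lemma bounded_bilinear_r x : bounded_linear (f x).
Proof.
case: hf => -[_ lf] [C C0 hC]; split; first exact: lf.
by exists (C * `|x|) => //; exact: mulr_ge0.
Qed.

End BoundedBilinear.

(** Viewing [K] as the normed module [K^o] over itself brings functionals under the lemmas on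
    bounded linear maps. *)
Lemma dual_eltP (E : normedModType K) (f : E -> K) :
  dual_elt f <-> bounded_linear (f : E -> K^o).
Proof.
split=> [[lf cf]|hf]; last first.
  by split; [case: hf|exact: bounded_linear_continuous hf].
split; first exact: lf.
exact: (@continuous_bound K E K^o).
Qed.

(** Continuity at 0 with tolerance 1 bounds $D(b)$ on the unit ball for $q_n(b)<d$; homogeneity is
    then used once in each variable. *)
Lemma cont_derivation_bound (V : lmodType K) (q : nat -> V -> K)
    (E : normedModType K) (D : V -> E -> K) :
  (forall n, is_seminorm (q n)) ->
  (forall a, dual_elt (D a)) ->
  (forall (k : K) a b x, D (k *: a + b) x = k * D a x + D b x) ->
  (forall a (e : K), 0 < e -> exists n, exists2 d : K, 0 < d &
     forall b, q n (b - a) < d ->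
       forall x : E, `|x| <= 1 -> `|D b x - D a x| <= e) ->
  exists n, exists2 C, 0 <= C & forall a x, `|D a x| <= C * q n a * `|x|.
Proof.
move=> sq dD lD cD.
have lDl x : linear_map ((D^~ x) : V -> K^o) by move=> k a b; apply: lD.
have lDr a : linear_map (D a : E -> K^o) by case: (dD a).
have [n [d d0 hd]] := cD 0 1 ltr01.
exists n, (1 / d) => [|a x]; first by rewrite divr_ge0// ltW.
rewrite mul1r -mulrA [_ * `|x|]mulrC mulrA [_ * `|x|]mulrC.
apply: (@homogeneous_bound _ _ (q n) (fun a => `|D a x|)) => //.
  by move=> k b; rewrite (linear_mapZ (lDl x)) normrM.
move=> b qb; rewrite -[leRHS]mul1r -[X in X * _]divr1.
apply: (@homogeneous_bound _ _ (fun x : E => `|x|) (fun x => `|D b x|)) => //.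
- exact: norm_seminorm.
- by move=> k z; rewrite (linear_mapZ (lDr b)) normrM.
move=> z /ltW z1; have := hd b; rewrite subr0 => /(_ qb z z1).
by rewrite (linear_map0 (lDl z)) subr0.
Qed.

End BoundedLinear.

(** * Existence of the Arens-Michael factors *)

Section Factors.
Variable K : numFieldType.
Hypothesis archi : forall e : K, 0 < e -> exists n : nat, n.+1%:R^-1 < e.
Hypothesis cK : seq_complete (fun x : K => `|x|).

(** The completion of [A] for $p_n$ serves; its product is obtained by extending $\varphi(ab)$ one
    factor at a time. *)
Lemma arens_michael_factor_exists (A : lmodType K) (mul : A -> A -> A)
    (p : nat -> A -> K) (n : nat) :
  is_algebra_mul mul -> is_seminorm (p n) ->
  (forall a b, p n (mul a b) <= p n a * p n b) ->
  exists (B : completeNormedModType K) (mulB : B -> B -> B) (phi : A -> B),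
    arens_michael_factor mul p n mulB phi.
Proof.
move=> [mulA mulDl mulDr] hp pM.
pose B := completion_completeNormedModType hp archi cK.
pose phi : A -> B := @embed _ _ _ hp archi cK.
have lphi : linear_map phi by exact: embed_linear.
have nphi a : `|phi a| = p n a by exact: norm_embed.
have dphi (y : B) e : 0 < e -> exists a, `|y - phi a| < e by exact: embed_dense.
have cB := @complete_seq_complete K B.
have p0 a : 0 <= p n a by exact: seminorm_ge0.
have [F1 [bF1 F1phi F1le]] : exists F : B -> A -> B, [/\ bilinear_map F,
    (forall a x, F (phi a) x = phi (mul a x)) &
    forall y x, `|F y x| <= 1 * `|y| * p n x].
  apply: (bilinear_extension lphi dphi archi cB p0) => //.
    by split=> [x k a b|a k x y]; rewrite ?mulDl ?mulDr lphi.
  by move=> a x; rewrite mul1r !nphi.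
(* [F1] has its left factor in [B] and its right factor still in [A]. Extending the latter puts the
   right factor first, so the product $yz$ is [F2 z y]. *)
have [F2 [bF2 F2phi F2le]] : exists F : B -> B -> B, [/\ bilinear_map F,
    (forall b y, F (phi b) y = F1 y b) &
    forall z y, `|F z y| <= 1 * `|z| * `|y|].
  apply: (bilinear_extension lphi dphi archi cB) => //.
    by case: bF1 => h1 h2; split=> [y|b]; [exact: h2|exact: h1].
  by move=> b y; rewrite nphi mulrAC.
have bF : bounded_bilinear F2 by split=> //; exists 1.
have Fl := bounded_bilinear_l bF; have Fr := bounded_bilinear_r bF.
have FF a b : F2 (phi b) (phi a) = phi (mul a b) by rewrite F2phi F1phi.
exists B, (fun y z => F2 z y), phi; split=> //; split.
  2: by move=> y z; have := F2le z y; rewrite mul1r mulrC.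
case: (bF2) => bl br; split; last 2 first.
- by move=> k a b c; exact: br.
- by move=> k a b c; exact: bl.
(* Associativity is carried over by density, one variable after another, to the image of [A]. *)
move=> y z w; move: w.
apply: (dense_ext dphi (f := fun w => F2 (F2 w z) y)
  (g := fun w => F2 w (F2 z y))).
- by apply: (bounded_linear_comp (g := F2^~ y) (f := F2^~ z)).
- exact: Fl.
move=> c; move: z.
apply: (dense_ext dphi (f := fun z => F2 (F2 (phi c) z) y)
  (g := fun z => F2 (phi c) (F2 z y))).
- by apply: (bounded_linear_comp (g := F2^~ y) (f := F2 (phi c))).
- by apply: (bounded_linear_comp (g := F2 (phi c)) (f := F2^~ y)).
move=> b; move: y.
apply: (dense_ext dphi (f := F2 (F2 (phi c) (phi b)))
  (g := fun y => F2 (phi c) (F2 (phi b) y))).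
- exact: Fr.
- exact: (bounded_linear_comp (g := F2 (phi c))).
by move=> a; rewrite !FF mulA.
Qed.

(** * Amenability passes to the factors *)

Lemma amenable_modulo_factor (A : lmodType K) (mul : A -> A -> A)
    (p : nat -> A -> K) (I : set A) (n : nat) (B : completeNormedModType K)
    (mulB : B -> B -> B) (phi : A -> B) :
  arens_michael_factor mul p n mulB phi -> amenable_modulo mul p I ->
  amenable_modulo mulB (@norm_family _ B) (closure_image phi I).
Proof.
move=> [_ lphi mphi nphi dphi] amA E l r.
move=> [[la lE] [ra rE] [lM rM lrM] [cl cr] [snl snr]] ann D [dD lD mD cD].
have sn m : is_seminorm (@norm_family K B m) by exact: norm_seminorm.
have phiB a b : norm_family 0 (phi b - phi a) = p n (b - a).
  by rewrite /norm_family -(linear_mapB lphi).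
have pull (W : normedModType K) (f : B -> W) :
    sn_continuous (@norm_family K B) f -> sn_continuous p (fun a => f (phi a)).
  move=> cf a e e0; have [m [d d0 hd]] := cf (phi a) e e0.
  by exists n, d => // b hb; apply: hd; rewrite -phiB in hb.
have [|||eta [deta etaP]] := amA E (fun a x => l (phi a) x)
    (fun x a => r x (phi a)) _ _ (fun a => D (phi a)).
- split; split=> //.
  + by move=> k a b x; rewrite lphi la.
  + by move=> k a b x; rewrite lphi ra.
  + by move=> a b x; rewrite mphi lM.
  + by move=> a b x; rewrite mphi rM.
  + by move=> x; apply: (pull _ (l^~ x)).
  + by move=> x; apply: (pull _ (r x)).
- move=> a x Ia; apply: ann => e e0; exists a => //.
  by rewrite subrr normr0.
- split=> //.
  + by move=> k a b x; rewrite lphi lD.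
  + by move=> a b x; rewrite mphi mD.
  + move=> a e e0; have [m [d d0 hd]] := cD (phi a) e e0.
    by exists n, d => // b hb; apply: hd; rewrite -phiB in hb.
exists eta; split=> // y nIy x.
have [_ [M M0 hM]] : bounded_linear (fun y => D y x : K^o).
  have [m [C C0 hC]] := cont_derivation_bound sn dD lD cD.
  split; first by move=> k a b; apply: lD.
  exists (C * `|x|) => [|z]; first exact: mulr_ge0.
  by rewrite mulrAC; apply: hC.
have heta : bounded_linear (eta : E -> K^o) by apply/dual_eltP.
have hl : bounded_linear (l^~ x).
  by apply: sn_continuous_bounded_linear (snl x) => k a b; apply: la.
have hr : bounded_linear (r x).
  by apply: sn_continuous_bounded_linear (snr x) => k a b; apply: ra.
(* The defect of the wanted identity is bounded and linear in $y$, and vanishes at $\varphi(a)$ for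
   every $a\notin I$. *)
pose h y : K^o := D y x - (eta (r x y) - eta (l y x)).
have [lh [C C0 hC]] : bounded_linear h.
  apply: (bounded_linearB (f := fun y => D y x : K^o)).
    split; first by move=> k a b; apply: lD.
    by exists M.
  apply: (bounded_linearB (f := fun y => eta (r x y) : K^o)
    (g := fun y => eta (l y x) : K^o)).
    exact: (bounded_linear_comp heta hr).
  exact: (bounded_linear_comp heta hl).
(* Being outside the closure, $y$ keeps a distance $e$ from $\varphi(I)$; any $\varphi(a)$ closer
   than $e$ to $y$ thus has $a\notin I$. *)
have [e e0 he] : exists2 e : K, 0 < e & forall a, I a -> ~ `|y - phi a| < e.
  apply: contrapT => ne; apply: nIy => e e0; apply: contrapT => na.
  by apply: ne; exists e => // a Ia ya; apply: na; exists a.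
apply/eqP; rewrite -subr_eq0; apply/eqP.
apply: (@small_norm _ K^o _ C) => // d d0.
have [c [c0 cd ce]] := pos_lower_bound d0 e0.
have [a ya] := dphi y c c0.
have nIa : ~ I a by move=> Ia; apply: (he a Ia); apply: lt_le_trans ya ce.
have ha : h (phi a) = 0 by rewrite /h etaP// subrr.
have -> : D y x - (eta (r x y) - eta (l y x)) = h (y - phi a).
  by rewrite (linear_mapB lh) ha subr0.
apply: le_trans (hC _) _; apply: ler_wpM2l => //.
by apply: le_trans (ltW ya) cd.
Qed.

(** * From the factors back to the algebra *)

Lemma closure_imageB (A : lmodType K) (B : normedModType K) (phi : A -> B)
    (I : set A) y z :
  linear_map phi -> (forall (k : K) x y, I x -> I y -> I (k *: x + y)) ->
  closure_image phi I y -> closure_image phi I z -> closure_image phi I (y - z).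
Proof.
move=> lphi lI Iy Iz e e0; have e20 : 0 < e / 2 by rewrite divr_gt0.
have [a Ia ya] := Iy _ e20; have [b Ib zb] := Iz _ e20.
exists (- 1 *: b + a); first exact: lI.
rewrite lphi scaleN1r.
have -> : y - z - (- phi b + phi a) = (y - phi a) - (z - phi b).
  by rewrite opprD opprK opprB addrACA [RHS]addrACA [- z - _]addrC.
apply: le_lt_trans (ler_normB _ _) _; rewrite [ltRHS]splitr.
exact: ltrD.
Qed.

Lemma amenable_modulo_of_factors (A : lmodType K) (mul : A -> A -> A)
    (p : nat -> A -> K) (I : set A) :
  frechet_algebra mul p -> closed_ideal mul p I ->
  (forall (n : nat) (B : completeNormedModType K) (mulB : B -> B -> B)
     (phi : A -> B),
     arens_michael_factor mul p n mulB phi ->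
     amenable_modulo mulB (@norm_family _ B) (closure_image phi I)) ->
  amenable_modulo mul p I.
Proof.
move=> [[malg sp] pM pS _ _] [[I0 lI _] Icl] amB E l r.
move=> [[la lE] [ra rE] [lM rM lrM] [cl cr] [snl snr]] ann D [dD lD mD cD].
(* When $I=A$ the condition on [eta] is vacuous and the zero functional works. *)
have [[a0 nIa0]|allI] := pselect (exists a, ~ I a); last first.
  exists (fun=> 0); split=> [|a nIa]; last by case: allI; exists a.
  apply/dual_eltP; split=> [k x y|]; first by rewrite scaler0 addr0.
  by exists 0 => // x; rewrite normr0 mul0r.
have p0 n a : 0 <= p n a by exact: seminorm_ge0.
have [nl [Cl Cl0 hCl]] : exists n, exists2 C, 0 <= C &
    forall a x, `|l a x| <= C * p n a * `|x|.
  apply: (separately_continuous_bound archi sp pS) => //.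
  by split=> [x k a b|a k x y]; rewrite ?la ?lE.
have [nr [Cr Cr0 hCr]] : exists n, exists2 C, 0 <= C &
    forall a x, `|r x a| <= C * p n a * `|x|.
  apply: (separately_continuous_bound archi sp pS
    (f := fun a x => r x a)) => //.
  by split=> [x k a b|a k x y]; rewrite ?ra ?rE.
have [nd [Cd Cd0 hCd]] := cont_derivation_bound sp dD lD cD.
(* Since $I$ is closed, one seminorm already separates $a_0$ from it. *)
have [m [e e0 hm]] : exists m, exists2 e : K, 0 < e &
    forall y, I y -> ~ p m (a0 - y) < e.
  apply: contrapT => nm; apply: nIa0; apply: Icl => m e e0.
  apply: contrapT => ny; apply: nm; exists m, e => // y Iy hy.
  by apply: ny; exists y.
(* One index at which $p_n$ controls both actions and $D$, and separates $a_0$ from $I$. *)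
pose n := maxn (maxn nl nr) (maxn nd m).
have [B [mulB [phi amf]]] := arens_michael_factor_exists malg (sp n) (pM n).
have := amB n B mulB phi amf; move: amf => [[Balg BM] lphi mphi nphi dphi] amBn.
have up k C : (k <= n)%N -> 0 <= C -> forall a (x : E),
    C * p k a * `|x| <= C * `|phi a| * `|x|.
  move=> kn C0 a x; rewrite nphi.
  apply: ler_wpM2r => //; apply: ler_wpM2l => //.
  exact: seminorms_le.
have nln : (nl <= n)%N by rewrite !leq_max leqnn.
have nrn : (nr <= n)%N by rewrite !leq_max leqnn orbT.
have ndn : (nd <= n)%N by rewrite !leq_max leqnn !orbT.
have mn : (m <= n)%N by rewrite !leq_max leqnn !orbT.
have cE := @complete_seq_complete K E.
have nE (x : E) : 0 <= `|x| by [].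
have [L [bL Lphi Lle]] : exists L : B -> E -> E, [/\ bilinear_map L,
    (forall a x, L (phi a) x = l a x) &
    forall y x, `|L y x| <= Cl * `|y| * `|x|].
  apply: (bilinear_extension lphi dphi archi cE nE) => //.
    by split=> [x k a b|a k x y]; rewrite ?la ?lE.
  by move=> a x; apply: le_trans (up _ _ nln Cl0 a x).
have [Q [bQ Qphi Qle]] : exists Q : B -> E -> E, [/\ bilinear_map Q,
    (forall a x, Q (phi a) x = r x a) &
    forall y x, `|Q y x| <= Cr * `|y| * `|x|].
  apply: (bilinear_extension lphi dphi archi cE nE) => //.
    by split=> [x k a b|a k x y]; rewrite ?ra ?rE.
  by move=> a x; apply: le_trans (up _ _ nrn Cr0 a x).
have [G [bG Gphi Gle]] : exists G : B -> E -> K^o, [/\ bilinear_map G,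
    (forall a x, G (phi a) x = D a x) &
    forall y x, `|G y x| <= Cd * `|y| * `|x|].
  apply: (bilinear_extension lphi dphi archi (Y := K^o) cK nE) => //.
    split=> [x k a b|a k x y]; first exact: lD.
    by have [lDa _] := dD a; apply: lDa.
  by move=> a x; apply: le_trans (up _ _ ndn Cd0 a x).
have bbL : bounded_bilinear L by split=> //; exists Cl.
have bbQ : bounded_bilinear Q by split=> //; exists Cr.
have bbG : bounded_bilinear G by split=> //; exists Cd.
have Ll := bounded_bilinear_l bbL; have Lr := bounded_bilinear_r bbL.
have Ql := bounded_bilinear_l bbQ; have Qr := bounded_bilinear_r bbQ.
have Gl := bounded_bilinear_l bbG; have Gr := bounded_bilinear_r bbG.
have bbM : bounded_bilinear mulB.
  case: Balg => _ h1 h2; split; first by split=> [x k y z|y k x z].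
  by exists 1 => // x y; rewrite mul1r.
have Ml := bounded_bilinear_l bbM; have Mr := bounded_bilinear_r bbM.
(* Each mixed identity is continuous in the two algebra variables, so it need only be checked on the
   image of [A], with $x$ fixed. *)
have bimB : banach_bimodule mulB (@norm_family _ B) L (fun x y => Q y x).
  split.
  - by case: bL => h1 h2; split=> *; rewrite ?h1 ?h2.
  - by case: bQ => h1 h2; split=> *; rewrite ?h1 ?h2.
  - split.
    + move=> y z x; move: z.
      apply: (dense_ext dphi (f := fun z => L (mulB y z) x)
        (g := fun z => L y (L z x))).
      * exact: (bounded_linear_comp (Ll x) (Mr y)).
      * exact: (bounded_linear_comp (Lr y) (Ll x)).
      move=> b; move: y.
      apply: (dense_ext dphi (f := fun y => L (mulB y (phi b)) x)
        (g := fun y => L y (L (phi b) x))).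
      * exact: (bounded_linear_comp (Ll x) (Ml (phi b))).
      * exact: Ll.
      by move=> a; rewrite -mphi !Lphi lM.
    + move=> y z x; move: z.
      apply: (dense_ext dphi (f := fun z => Q (mulB y z) x)
        (g := fun z => Q z (Q y x))).
      * exact: (bounded_linear_comp (Ql x) (Mr y)).
      * exact: Ql.
      move=> b; move: y.
      apply: (dense_ext dphi (f := fun y => Q (mulB y (phi b)) x)
        (g := fun y => Q (phi b) (Q y x))).
      * exact: (bounded_linear_comp (Ql x) (Ml (phi b))).
      * exact: (bounded_linear_comp (Qr (phi b)) (Ql x)).
      by move=> a; rewrite -mphi !Qphi rM.
    + move=> y z x; move: z.
      apply: (dense_ext dphi (f := fun z => L y (Q z x))
        (g := fun z => Q z (L y x))).
      * exact: (bounded_linear_comp (Lr y) (Ql x)).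
      * exact: Ql.
      move=> b; move: y.
      apply: (dense_ext dphi (f := fun y => L y (Q (phi b) x))
        (g := fun y => Q (phi b) (L y x))).
      * exact: Ll.
      * exact: (bounded_linear_comp (Qr (phi b)) (Ll x)).
      by move=> a; rewrite !Lphi !Qphi lrM.
  - by split=> y; apply: bounded_linear_continuous.
  - by split=> x; apply: bounded_linear_sn_continuous.
(* An action that is zero on $\varphi(I)$ is zero on its closure by continuity. *)
have vanish (F : B -> E -> E) : bounded_bilinear F ->
    (forall a x, I a -> F (phi a) x = 0) ->
    forall y x, closure_image phi I y -> F y x = 0.
  move=> bF F0 y x Iy; have [lF [C C0 hC]] := bounded_bilinear_l bF x.
  apply: (small_norm C0) => d d0; have [a Ia /ltW ya] := Iy d d0.
  rewrite -[F y x]subr0 -(F0 a x Ia) -(linear_mapB lF).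
  by apply: le_trans (hC _) _; apply: ler_wpM2l.
have annL : forall y x, closure_image phi I y -> L y x = 0.
  by apply: vanish => // a x Ia; rewrite Lphi; have [] := ann a x Ia.
have annQ : forall y x, closure_image phi I y -> Q y x = 0.
  by apply: vanish => // a x Ia; rewrite Qphi; have [] := ann a x Ia.
have derG : cont_derivation mulB (@norm_family _ B) L (fun x y => Q y x) G.
  split.
  - by move=> y; apply/dual_eltP.
  - by case: bG => h _ k y z x; apply: h.
  - move=> y z x; move: z.
    apply: (dense_ext dphi (f := fun z => G (mulB y z) x)
      (g := fun z => G z (Q y x) + G y (L z x))).
    + exact: (bounded_linear_comp (Gl x) (Mr y)).
    + exact: (bounded_linearD (Gl _) (bounded_linear_comp (Gr y) (Ll x))).
    move=> b; move: y.
    apply: (dense_ext dphi (f := fun y => G (mulB y (phi b)) x)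
      (g := fun y => G (phi b) (Q y x) + G y (L (phi b) x))).
    + exact: (bounded_linear_comp (Gl x) (Ml (phi b))).
    + exact: (bounded_linearD (bounded_linear_comp (Gr (phi b)) (Ql x)) (Gl _)).
    by move=> a; rewrite -mphi !Gphi Qphi Lphi mD.
  - move=> y t t0; have C1 : 0 < Cd + 1 by rewrite ltr_wpDl.
    exists 0%N, (t / (Cd + 1)) => [|z]; first by rewrite divr_gt0.
    rewrite /norm_family ltr_pdivlMr// => hz x x1.
    have -> : G z x - G y x = G (z - y) x.
      by have [h _] := Gl x; rewrite (linear_mapB h).
    apply: le_trans (Gle _ _) _; apply: le_trans (ltW hz).
    rewrite -[leRHS]mulr1; apply: ler_pM => //; first exact: mulr_ge0.
    by rewrite mulrC; apply: ler_wpM2l => //; rewrite lerDl.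
have [|eta [deta etaP]] := amBn E L (fun x y => Q y x) bimB _ G derG.
  by move=> y x Iy; rewrite annL// annQ.
have nIphi0 : ~ closure_image phi I (phi a0).
  move=> /(_ e e0)[a Ia]; rewrite -(linear_mapB lphi) nphi => ha.
  apply: (hm a Ia); apply: le_lt_trans ha; exact: seminorms_le.
have [leta _] : bounded_linear (eta : E -> K^o) by apply/dual_eltP.
exists eta; split=> // a nIa x; rewrite -Gphi -Lphi -Qphi.
(* The delicate case is $a\notin I$ with $\varphi(a)$ in the closure: [etaP] does not apply, and
   $G(\varphi(a),x)=0$ has to be shown. *)
have [Ia|] := pselect (closure_image phi I (phi a)); last first.
  by move=> nIphi; rewrite etaP.
rewrite annL// annQ// subrr.
have nIs : ~ closure_image phi I (phi a0 + phi a).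
  move=> Is; apply: nIphi0; rewrite -(addrK (phi a) (phi a0)).
  exact: closure_imageB.
(* Expand the formula at $\varphi(a_0)+\varphi(a)$: the action terms of $\varphi(a)$ vanish, and
   cancelling the formula at $\varphi(a_0)$ leaves $G(\varphi(a),x)=0$. *)
have := etaP _ nIs x; have [lGx _] := Gl x.
have [lLx _] := Ll x; have [lQx _] := Ql x.
rewrite (linear_mapD lGx) (linear_mapD lLx) (linear_mapD lQx).
rewrite (annL _ x Ia) (annQ _ x Ia).
rewrite !addr0 -etaP// => h; apply: (addrI (G (phi a0) x)).
by rewrite addr0.
Qed.

End Factors.

(** * Archimedean property and completeness of the complex numbers *)

Section ComplexScalars.
Variable R : realType.
Local Notation Re := complex.Re.
Local Notation Im := complex.Im.

(** A positive complex number is real, so the property descends to its real part. *)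
Lemma complex_archi (e : R[i]) : 0 < e -> exists n : nat, n.+1%:R^-1 < e.
Proof.
move=> e0; have ee : (Re e)%:C = e by rewrite RRe_real// ger0_real// ltW.
have re0 : 0 < Re e by rewrite -ltcR ee.
exists (Num.truncn (Re e)^-1).
rewrite -ee -[_.+1%:R](rmorph_nat (real_complex R)).
rewrite -fmorphV ltcR -[ltRHS]invrK ltf_pV2 ?posrE ?invr_gt0//.
exact: truncnS_gt.
Qed.

Lemma norm_real_complex (x : R) : `|x%:C| = `|x|%:C.
Proof. by rewrite normc_def /= expr0n addr0 sqrtr_sqr. Qed.

Lemma norm_complexi : `|'i%C : R[i]| = 1.
Proof. by rewrite normc_def /= expr0n add0r expr1n sqrtr1. Qed.

(** Multiplication by $i$ is isometric and turns the imaginary part into minus a real part. *)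
Lemma normc_ge_Im (z : R[i]) : `|Im z|%:C <= `|z|.
Proof.
rewrite -(normrN (Im z)) -ReiNIm; apply: le_trans (normc_ge_Re _) _.
by rewrite normrM norm_complexi mulr1.
Qed.

Lemma normc_le_ReIm (z : R[i]) : `|z| <= `|Re z|%:C + `|Im z|%:C.
Proof.
rewrite {1}[z]complexE; apply: le_trans (ler_normD _ _) _.
by rewrite normrM norm_complexi mul1r !norm_real_complex.
Qed.

(** Real and imaginary parts are contractions, so both part sequences are Cauchy in the complete
    field [R]; their limits are the parts of the limit. *)
Lemma complex_seq_complete : seq_complete (fun x : R[i] => `|x|).
Proof.
move=> u cu.
have part (f : R[i] -> R) : (forall x y, f (x - y) = f x - f y) ->
    (forall x, `|f x|%:C <= `|x|) ->
    exists l, seq_lim (fun x : R => `|x|) (fun i => f (u i)) l.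
  move=> fB fle; apply: complete_seq_complete => e e0.
  have e0' : 0 < e%:C :> R[i] by rewrite ltcR.
  have [N hN] := cu _ e0'; exists N => i j Ni Nj.
  by rewrite -fB -ltcR; apply: le_lt_trans (fle _) (hN i j Ni Nj).
have [||a ha] := part (@Re R).
- by move=> [? ?] [? ?].
- exact: normc_ge_Re.
have [||b hb] := part (@Im R).
- by move=> [? ?] [? ?].
- exact: normc_ge_Im.
exists (a +i* b)%C => e e0.
have ee : (Re e)%:C = e by rewrite RRe_real// ger0_real// ltW.
have re0 : 0 < Re e / 2 by rewrite divr_gt0// -ltcR ee.
have [N hN] := ha _ re0; have [M hM] := hb _ re0.
exists (maxn N M) => i; rewrite geq_max => /andP[/hN + /hM].
rewrite -ee => h1 h2; apply: le_lt_trans (normc_le_ReIm _) _.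
rewrite -rmorphD ltcR [ltRHS]splitr.
by case: (u i) h1 h2 => c d /= h1 h2; apply: ltrD.
Qed.

End ComplexScalars.

Theorem theorem2p3 (R : realType) (A : lmodType R[i]) (mul : A -> A -> A)
  (p : nat -> A -> R[i]) (I : set A) :
  frechet_algebra mul p -> closed_ideal mul p I ->
  amenable_modulo mul p I <->
  (forall (n : nat) (B : completeNormedModType R[i]) (mulB : B -> B -> B)
     (phi : A -> B),
     arens_michael_factor mul p n mulB phi ->
     amenable_modulo mulB (@norm_family _ B) (closure_image phi I)).
Proof.
move=> fA cI; split=> [amA n B mulB phi amf|].
  exact: amenable_modulo_factor amf amA.
exact: (amenable_modulo_of_factors (@complex_archi R)
  (@complex_seq_complete R)).
Qed.
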